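(* Let $X$ be a real Banach space with topological dual $X^{*}$, and let $A, B : X \rightarrow 2^{X^{*}}$ be linear multi-valued maximal monotone operators. Assume that $D(A) - D(B) := \{a - b : a \in D(A),\ b \in D(B)\}$ is closed in $X$ (with respect to the norm topology). Then $A + B$ is maximal monotone.
   Context: $X$ is a real Banach space (not assumed reflexive), $X^{*}$ is its topological dual, and $\langle x, x^{*}\rangle = x^{*}(x)$ denotes the duality pairing for $x\in X$, $x^{*}\in X^{*}$. A multi-valued operator $A : X \rightarrow 2^{X^{*}}$ assigns to each $x\in X$ a (possibly empty) subset $Ax \subseteq X^{*}$; it is identified with its graph $\{(x,x^{*})\in X\times X^{*} : x^{*}\in Ax\}$. Its domain is $D(A) = \{x\in X : Ax \neq \emptyset\}$. The multi-valued operator $A$ is linear if its graph is a linear subspace of $X\times X^{*}$. The operator $A$ is monotone if $\langle x - y, x^{*} - y^{*}\rangle \ge 0$ for all $(x,x^{*}), (y,y^{*})$ in the graph of $A$. It is maximal monotone if it is monotone and its graph is not properly contained in the graph of any other monotone operator from $X$ to $2^{X^{*}}$ (linear or not); equivalently, $A$ is monotone and every $(x_0,x_0^{*})\in X\times X^{*}$ satisfying $\langle x - x_0, x^{*} - x_0^{*}\rangle \ge 0$ for all $(x,x^{*})$ in the graph of $A$ belongs to the graph of $A$. The (Minkowski) sum $A+B$ is the operator defined by $(A+B)x = Ax + Bx = \{a^{*}+b^{*} : a^{*}\in Ax,\ b^{*}\in Bx\}$, with domain $D(A+B) = D(A)\cap D(B)$. *)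

(* Defs.v *)
From HB Require Import structures.
From mathcomp Require Import all_boot all_order all_algebra.
From mathcomp Require Import all_classical all_reals all_analysis.

Set Implicit Arguments.
Unset Strict Implicit.
Unset Printing Implicit Defensive.

Import GRing.Theory numFieldNormedType.Exports.
Local Open Scope classical_set_scope.
Local Open Scope ring_scope.

Section TopologicalDual.
Context {R : realType} {X : normedModType R}.

Definition continuous_functional : {pred X -> R^o} :=
  [in [set f : X -> R^o | linear f /\ continuous f]].

Lemma continuous_functional_submod : submod_closed continuous_functional.
Proof.
split.
  rewrite inE; split; last by move=> x; exact: cvg_cst.
  by move=> a u v; rewrite /= scaler0 addr0.
move=> a f g; rewrite !inE => -[lf cf] [lg cg]; split.
  move=> b u v.
  rewrite -[LHS]/(a *: f (b *: u + v) + g (b *: u + v)) lf lg.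
  rewrite -[RHS]/(b *: (a *: f u + g u) + (a *: f v + g v)).
  by rewrite !scalerDr !scalerA (mulrC a b) addrACA.
move=> x; apply: cvgD; last exact: cg.
by apply: cvgZr; exact: cf.
Qed.

HB.instance Definition _ := GRing.isSubmodClosed.Build R (X -> R^o)
  continuous_functional continuous_functional_submod.

End TopologicalDual.

Record dual (R : realType) (X : normedModType R) := Dual {
  functional :> X -> R^o ;
  functionalP : functional \in continuous_functional
}.

Section DualLmodule.
Context {R : realType} {X : normedModType R}.
HB.instance Definition _ := [isSub for @functional R X].
HB.instance Definition _ := [Choice of dual X by <:].
HB.instance Definition _ := [SubChoice_isSubLmodule of dual X by <:].

Lemma functional_linear (f : dual X) : linear f.
Proof. by have := functionalP f; rewrite inE => -[]. Qed.

Lemma functional_continuous (f : dual X) : continuous f.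
Proof. by have := functionalP f; rewrite inE => -[]. Qed.

HB.instance Definition _ (f : dual X) :=
  GRing.isLinear.Build R X R^o *:%R f (functional_linear f).

End DualLmodule.

Definition pairing (R : realType) (X : normedModType R) (x : X) (f : dual X) : R :=
  f x.

Section MultivaluedOperators.
Context {R : realType} {X : normedModType R}.
Implicit Types A B : X -> set (dual X).

Definition op_graph A : set (X * dual X) := [set z | A z.1 z.2].

Definition op_domain A : set X := [set x | A x !=set0].

Definition linear_op A : Prop := submod_closed [in op_graph A].

Definition monotone_op A : Prop :=
  forall z w : X * dual X, op_graph A z -> op_graph A w ->
    0 <= pairing (z.1 - w.1) (z.2 - w.2).

Definition maximal_monotone A : Prop :=
  monotone_op A /\
  forall B, monotone_op B -> ~ (op_graph A `<` op_graph B).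

Definition op_sum A B : X -> set (dual X) :=
  fun x => [set a + b | a in A x & b in B x].

End MultivaluedOperators.

(* Main.v *)
Require Import Defs.
From HB Require Import structures.
From mathcomp Require Import all_boot all_order all_algebra.
From mathcomp Require Import all_classical all_reals all_analysis.
From mathcomp Require Import ring lra.

(* Let (x0, h0) be monotonically related to A + B. For (a, f) in A and (b, g)
   in B put gap = <a - x0, f> + <b - x0, g - h0>. This function is convex on
   the linear space A x B and nonnegative where a = b. The open mapping argument
   for (a, f, b, g) |-> a - b, whose range is the closed space D(A) - D(B),
   upgrades this to gap >= - L |a - b|, and the Hahn-Banach theorem then gives
   z in the dual with gap >= <a - b, z>, that is,
     <a - x0, f - z> + <b - x0, g - (h0 - z)> >= 0
   for all (a, f) in A and (b, g) in B independently. By maximality neither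
   summand can be bounded below by a positive constant, so both are nonnegative,
   hence (x0, z) is in A and (x0, h0 - z) is in B. *)

Set Implicit Arguments.
Unset Strict Implicit.
Unset Printing Implicit Defensive.

Import Order.TTheory GRing.Theory Num.Theory numFieldNormedType.Exports.
Local Open Scope classical_set_scope.
Local Open Scope ring_scope.

(** * Sublinear functions and the Hahn-Banach theorem *)

Definition sublinear {R : realType} {V : lmodType R} (q : V -> R) : Prop :=
  (forall x y, q (x + y) <= q x + q y) /\
  (forall t x, 0 <= t -> q (t *: x) <= t * q x).

Lemma sublinear0 (R : realType) (V : lmodType R) (q : V -> R) :
  sublinear q -> q 0 = 0.
Proof.
move=> [qD qZ]; have := qD 0 0; have := qZ 0 0 (lexx _).
by rewrite scale0r addr0; lra.
Qed.

Lemma sublinearN (R : realType) (V : lmodType R) (q : V -> R) x :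
  sublinear q -> - q (- x) <= q x.
Proof.
move=> sq; have := sq.1 x (- x); rewrite subrr sublinear0 //; lra.
Qed.

Lemma le_infM (R : realType) (E : set R) (c s : R) : E !=set0 -> 0 <= s ->
  (forall e, E e -> c <= s * e) -> c <= s * inf E.
Proof.
move=> E0 s0 cE; move: (s0); rewrite le_eqVlt => /predU1P[s_0|s_gt0].
  by case: E0 => e /cE; rewrite -s_0 !mul0r.
rewrite mulrC -ler_pdivrMr//; apply: lb_le_inf => // e /cE.
by rewrite ler_pdivrMr// mulrC.
Qed.

Lemma le_infD (R : realType) (E F : set R) (c : R) : E !=set0 -> F !=set0 ->
  (forall e f, E e -> F f -> c <= e + f) -> c <= inf E + inf F.
Proof.
move=> E0 F0 cEF; rewrite -lerBlDl; apply: lb_le_inf => // f Ff.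
rewrite lerBlDl -lerBlDr; apply: lb_le_inf => // e Ee.
by rewrite lerBlDr; exact: cEF.
Qed.

(** It is enough that sums and nonnegative multiples of elements of the sets [E x] dominate some
    element of the set at the sum or multiple. This serves for chains, for the perturbation along a
    fixed vector and for the sandwich functional. *)
Lemma inf_sublinear (R : realType) (V : lmodType R) (E : V -> set R) :
  (forall x, E x !=set0) -> (forall x, has_lbound (E x)) ->
  (forall x y e f, E x e -> E y f -> exists2 g, E (x + y) g & g <= e + f) ->
  (forall t x e, 0 <= t -> E x e -> exists2 g, E (t *: x) g & g <= t * e) ->
  sublinear (fun x => inf (E x)).
Proof.
move=> E0 lbE ED EZ; split=> [x y|t x t0].
  apply: le_infD => // e f Ee Ef; have [g Eg] := ED _ _ _ _ Ee Ef.
  by apply: le_trans; exact: ge_inf.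
apply: le_infM => // e Ee; have [g Eg] := EZ _ _ _ t0 Ee.
by apply: le_trans; exact: ge_inf.
Qed.

(** Each member satisfies q x >= - q (- x) >= - p (- x), so the infimum is finite. For
    subadditivity, the smaller of two comparable members serves both arguments. *)
Lemma chain_inf_sublinear (R : realType) (V : lmodType R) (p : V -> R)
    (F : set (V -> R)) : F !=set0 ->
  (forall q, F q -> sublinear q /\ forall x, q x <= p x) ->
  (forall q r, F q -> F r ->
    (forall x, q x <= r x) \/ (forall x, r x <= q x)) ->
  sublinear (fun x => inf [set q x | q in F]) /\
  (forall q x, F q -> inf [set q x | q in F] <= q x).
Proof.
move=> [q0 Fq0] Fp Fc.
have lbF x : has_lbound [set q x | q in F].
  exists (- p (- x)) => _ [q /Fp[sq qp] <-].
  by apply: le_trans (sublinearN x sq); rewrite lerN2.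
split; last by move=> q x Fq; apply: ge_inf => //; exists q.
apply: inf_sublinear => // [x|x y e f [q Fq <-] [r Fr <-]|t x e t0 [q Fq <-]].
- by exists (q0 x); exists q0.
- have [[[qD _] _] [[rD _] _]] := (Fp _ Fq, Fp _ Fr).
  have [qr|rq] := Fc _ _ Fq Fr.
    exists (q (x + y)); first by exists q.
    by apply: le_trans (qD _ _) _; rewrite lerD2l.
  exists (r (x + y)); first by exists r.
  by apply: le_trans (rD _ _) _; rewrite lerD2r.
- exists (q (t *: x)); first by exists q.
  by apply: (Fp _ Fq).1.2.
Qed.

Lemma minimal_sublinear (R : realType) (V : lmodType R) (p : V -> R) :
  sublinear p -> exists q, [/\ sublinear q, forall x, q x <= p x &
    forall r, sublinear r -> (forall x, r x <= q x) -> r = q].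
Proof.
move=> sp.
pose T := {q : V -> R | sublinear q /\ forall x, q x <= p x}.
(* The order is reversed: larger for [le_T] means pointwise smaller, so Zorn's lemma yields a
   minimal function and chains are bounded by their pointwise infimum. *)
pose le_T (q r : T) := `[< forall x, sval r x <= sval q x >].
have [||||q qmin] := @Zorn T le_T.
- by move=> q; apply/asboolP.
- move=> r q s /asboolP rq /asboolP qs; apply/asboolP => x.
  exact: le_trans (qs x) (rq x).
- move=> [q ?] [r ?] /asboolP /= rq /asboolP /= qr; apply: eq_exist.
  by apply/funext => x; apply/eqP; rewrite eq_le rq qr.
- move=> A Ac; have [[q0 Aq0]|A0] := pselect (A !=set0); last first.
    exists (exist _ p (conj sp (fun x => lexx (p x)))) => q Aq.
    by case: A0; exists q.
  pose F := [set sval q | q in A].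
  have [|q [r _ <-]|q r [q' Aq <-] [r' Ar <-]|sF Fle] :=
      @chain_inf_sublinear R V p F.
  + by exists (sval q0); exists q0.
  + exact: (svalP r).
  + by have [/asboolP ?|/asboolP ?] := Ac _ _ Aq Ar; [right|left].
  + have Fp x : inf [set q x | q in F] <= p x.
      apply: le_trans (Fle (sval q0) x _) _; first by exists q0.
      exact: (svalP q0).2.
    exists (exist _ (fun x => inf [set q x | q in F]) (conj sF Fp)) => q Aq.
    apply/asboolP => x /=.
    by apply: Fle; exists q.
- have [sq qp] := svalP q; exists (sval q); split => // r sr rq.
  have rp x : r x <= p x := le_trans (rq x) (qp x).
  by have <- := qmin (exist _ r (conj sr rp)) (asboolT rq).
Qed.

(* For fixed y, the infimum of q (z + t y) - t q y over t >= 0 is sublinear in z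
   and below q; minimality and t = 1 give q x <= q (x + y) - q y. *)
Lemma minimal_sublinear_additive (R : realType) (V : lmodType R) (q : V -> R) :
  sublinear q ->
  (forall r, sublinear r -> (forall x, r x <= q x) -> r = q) ->
  forall x y, q (x + y) = q x + q y.
Proof.
move=> sq qmin x y; have [qD qZ] := sq.
pose E z := [set q (z + t *: y) - t * q y | t in [set t | 0 <= t]].
have Eq z : E z (q z) by exists 0 => /=; rewrite ?scale0r ?mul0r ?addr0 ?subr0.
have lbE z : has_lbound (E z).
  exists (- q (- z)) => _ [t /= t0 <-].
  have := qD (z + t *: y) (- z); rewrite addrC addKr => qty.
  suff : t * q y <= q (t *: y) by lra.
  move: (t0); rewrite le_eqVlt => /predU1P[<-|t_gt0].
    by rewrite mul0r scale0r sublinear0.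
  (* The reverse of [qZ] for t > 0 comes from [qZ] with factor t^-1 at the point t y. *)
  rewrite mulrC -ler_pdivlMr// mulrC.
  have := qZ t^-1 (t *: y); rewrite scalerA mulVf ?gt_eqF// scale1r.
  by apply; rewrite invr_ge0.
have sE : sublinear (fun z => inf (E z)).
  apply: inf_sublinear => // [z|z w _ _ [t /= t0 <-] [u /= u0 <-]|].
  - by exists (q z).
  - exists (q (z + w + (t + u) *: y) - (t + u) * q y).
      by exists (t + u) => //=; rewrite addr_ge0.
    have := qD (z + t *: y) (w + u *: y).
    by rewrite addrACA -scalerDl mulrDl; lra.
  - move=> s z _ s0 [t /= t0 <-].
    exists (q (s *: z + (s * t) *: y) - s * t * q y).
      by exists (s * t) => //=; rewrite mulr_ge0.
    by have := qZ s (z + t *: y) s0; rewrite scalerDr scalerA; lra.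
have := qmin _ sE (fun z => ge_inf (lbE z) (Eq z)).
move=> /(congr1 (fun f => f x)) /= Ex.
have : inf (E x) <= q (x + 1 *: y) - 1 * q y.
  by apply: ge_inf => //; exists 1; rewrite //= ler01.
by rewrite Ex scale1r mul1r; have := qD x y; lra.
Qed.

(** A minimal sublinear function below p is linear: additivity makes it odd, and the homogeneity
    inequality at x and at - x then becomes an equality. *)
Lemma hahn_banach_sublinear (R : realType) (V : lmodType R) (p : V -> R) :
  sublinear p ->
  exists f : V -> R^o, linear f /\ forall x, f x <= p x.
Proof.
move=> /minimal_sublinear[q [sq qp qmin]]; exists q; split => //.
have qD := minimal_sublinear_additive sq qmin.
have qN x : q (- x) = - q x.
  by have := qD x (- x); rewrite subrr sublinear0//; lra.
have qZ t x : 0 <= t -> q (t *: x) = t * q x.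
  move=> t0; have := sq.2 t x t0; have := sq.2 t (- x) t0.
  by rewrite scalerN !qN; lra.
move=> t x y; rewrite qD; congr (_ + _); have [t0|/ltW t0] := leP 0 t.
  exact: qZ.
have := qZ (- t) x; rewrite oppr_ge0 scaleNr qN mulNr => /(_ t0).
by move/oppr_inj.
Qed.

(** * Bounded functionals and the sandwich theorem *)

Lemma bounded_linear_dual (R : realType) (X : normedModType R) (f : X -> R^o)
    (L : R) :
  linear f -> (forall x, `|f x| <= L * `|x|) ->
  exists z : dual X, forall x, z x = f x.
Proof.
move=> lf fL.
pose F : {linear X -> R^o} := HB.pack f (GRing.isLinear.Build _ _ _ _ f lf).
have cF : continuous F.
  apply/bounded_linear_continuous/linear_boundedP.
  near=> r => x; apply: le_trans (fL x) _.
  by apply: ler_wpM2r => //; near: r; apply: nbhs_pinfty_ge; rewrite num_real.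
have fP : f \in @continuous_functional R X by rewrite inE.
by exists (Dual fP).
Unshelve. all: by end_near. Qed.

Lemma dual_bounded (R : realType) (X : normedModType R) (z : dual X) :
  exists2 L : R, 0 < L & forall x, `|z x| <= L * `|x|.
Proof.
have /continuous_linear_bounded/linear_boundedP : {for 0, continuous z}.
  exact: functional_continuous.
move=> zL.
have : \forall r \near +oo, 0 < r /\ forall x, `|z x| <= r * `|x|.
  near=> r; split; last by near: r.
  by near: r; apply: nbhs_pinfty_gt; rewrite num_real.
by move=> /filter_ex[r [? ?]]; exists r.
Unshelve. all: by end_near. Qed.

(* The sublinear function fed to Hahn-Banach is the infimum over t >= 0, w in G
   of t k(w) + L |x - t T w|. *)
Lemma convex_sandwich (R : realType) (X : normedModType R) (W : lmodType R)
    (G : set W) (k : W -> R) (T : {linear W -> X}) (L : R) :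
  G !=set0 -> 0 <= L ->
  (forall s t u v, 0 <= s -> 0 <= t -> s + t = 1 -> G u -> G v ->
    G (s *: u + t *: v) /\ k (s *: u + t *: v) <= s * k u + t * k v) ->
  (forall w, G w -> - (L * `|T w|) <= k w) ->
  exists z : dual X, forall w, G w -> z (T w) <= k w.
Proof.
move=> [w0 Gw0] L0 Gconv kL.
pose E x := [set e | exists t w, [/\ 0 <= t, G w &
  e = t * k w + L * `|x - t *: T w|]].
have Ele x : E x (L * `|x|).
  by exists 0, w0; rewrite lexx mul0r add0r scale0r subr0.
have Ege x e : E x e -> - (L * `|x|) <= e.
  move=> [t [w [t0 Gw ->]]].
  have : t * - (L * `|T w|) <= t * k w by rewrite ler_wpM2l// kL.
  have : L * `|t *: T w| <= L * (`|x| + `|x - t *: T w|).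
    by rewrite ler_wpM2l// -{1}(subKr x (t *: T w)) ler_normB.
  by rewrite normrZ ger0_norm// mulrDr; lra.
have lbE x : has_lbound (E x) by exists (- (L * `|x|)) => e /Ege.
have /hahn_banach_sublinear[f [lf fE]] : sublinear (fun x => inf (E x)).
  apply: inf_sublinear => //.
  - by move=> x; exists (L * `|x|).
  - move=> x y _ _ [t [w [t0 Gw ->]]] [u [v [u0 Gv ->]]].
    (* The weights t and u are normalized by t + u to apply convexity of k; if the sum is 0, both
       vanish and only the norm terms remain. *)
    have [tu0|tu_neq0] := eqVneq (t + u) 0.
      have [-> ->] : t = 0 /\ u = 0 by split; lra.
      exists (L * `|x + y|); first exact: Ele.
      rewrite !mul0r !scale0r !subr0 !add0r -mulrDr ler_wpM2l//.
      exact: ler_normD.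
    have tu_gt0 : 0 < t + u by rewrite lt_def tu_neq0 addr_ge0.
    have [|||Gwv kwv] := Gconv (t / (t + u)) (u / (t + u)) w v _ _ _ Gw Gv.
    + by rewrite divr_ge0// ltW.
    + by rewrite divr_ge0// ltW.
    + by rewrite -mulrDl divff.
    pose wv := t / (t + u) *: w + u / (t + u) *: v.
    exists ((t + u) * k wv + L * `|x + y - (t + u) *: T wv|).
      by exists (t + u), wv; split => //; exact: ltW.
    have -> : (t + u) *: T wv = t *: T w + u *: T v.
      rewrite /wv linearD !linearZ/= scalerDr !scalerA.
      by rewrite !(mulrC (t + u)) !divfK.
    have : (t + u) * k wv <= t * k w + u * k v.
      rewrite -ler_pdivlMl//; apply: le_trans kwv _.
      by rewrite le_eqVlt; apply/predU1P; left; field.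
    have : L * `|x + y - (t *: T w + u *: T v)|
        <= L * (`|x - t *: T w| + `|y - u *: T v|).
      by rewrite ler_wpM2l// opprD addrACA ler_normD.
    by rewrite mulrDr; lra.
  - move=> s x _ s0 [t [w [t0 Gw ->]]].
    exists (s * t * k w + L * `|s *: x - (s * t) *: T w|).
      by exists (s * t), w; split => //; exact: mulr_ge0.
    rewrite -scalerA -scalerBr normrZ ger0_norm//.
    by rewrite le_eqVlt; apply/predU1P; left; ring.
pose F : {linear X -> R^o} := HB.pack f (GRing.isLinear.Build _ _ _ _ f lf).
have fL x : f x <= L * `|x| by apply: le_trans (fE x) _; exact: ge_inf.
have [|z zf] := bounded_linear_dual (f := f) (L := L) lf.
  move=> x; rewrite ler_norml fL andbT lerNl -normrN.
  by rewrite -[- f x](raddfN F); exact: fL.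
(* With t = 1 and x = T w the norm term vanishes, so k w belongs to [E (T w)]. *)
exists z => w Gw; rewrite zf; apply: le_trans (fE _) _; apply: ge_inf => //.
by exists 1, w; rewrite scale1r subrr normr0 mulr0 addr0 mul1r.
Qed.

(** * Completeness: Baire category and sigma-convex sets *)

Lemma cauchy_rate_cvg (R : realType) (X : completeNormedModType R)
    (u : nat -> X) (r : nat -> R) :
  r @ \oo --> 0 -> (forall n m, (n <= m)%N -> `|u m - u n| <= r n) ->
  exists2 l, u @ \oo --> l & forall n, `|l - u n| <= r n.
Proof.
move=> r0 ur.
have cu : cvg (u @ \oo).
  apply/cauchy_cvgP/cauchyP => e e0.
  have /cvgrPdist_lt/(_ _ e0)[n _ rn] := r0.
  exists (u n), n => // m /= nm.
  rewrite -ball_normE /= distrC; apply: le_lt_trans (ur _ _ nm) _.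
  by have := rn n (leqnn n); rewrite /= sub0r normrN; exact/le_lt_trans/ler_norm.
exists (lim (u @ \oo)) => // n.
have /cvg_norm : u m - u n @[m --> \oo] --> lim (u @ \oo) - u n.
  by apply: cvgB => //; exact: cvg_cst.
move/cvgr_to_le; apply; exists n => // m /= nm; exact: ur.
Qed.

Lemma halves_cvg0 (R : realType) (a : R) : a / 2 ^+ n @[n --> \oo] --> 0.
Proof.
have := @cvg_geometric R a 2^-1; rewrite ger0_norm ?invr_ge0//.
rewrite invf_lt1// ltr1n => /(_ isT); apply: cvg_trans.
by under [X in X @ _]eq_fun do rewrite /= -exprVn.
Qed.

(** The sets F n are arbitrary, so the conclusion is density of some F n in a ball of E. Otherwise
    every ball centred in E contains a smaller one centred in E and at positive distance from F n;
    the centres of the nested balls converge to a point of E outside every F n. *)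
Lemma baire_closed (R : realType) (X : completeNormedModType R) (E : set X)
    (F : nat -> set X) :
  closed E -> E !=set0 -> E `<=` \bigcup_n F n ->
  exists n x r, [/\ 0 < r, E x & forall e, E e -> `|e - x| < r ->
    forall eps, 0 < eps -> exists2 c, F n c & `|e - c| < eps].
Proof.
move=> cE [x0 Ex0] EF; apply: contrapT => nF.
(* One step of the construction: from an index, a centre and a radius to a new centre and radius.
   The premises sit inside the existential so that choice gives a total function. *)
have : forall p : nat * (X * R), exists q : X * R, E p.2.1 -> 0 < p.2.2 ->
    [/\ E q.1, 0 < q.2, q.2 <= p.2.2 / 2, `|q.1 - p.2.1| + q.2 <= p.2.2 &
      forall c, F p.1 c -> q.2 < `|q.1 - c|].
  move=> [n [x r]] /=.
  have [[Ex r0]|] := pselect (E x /\ 0 < r); last first.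
    by move=> nEr; exists (x, r) => Ex r0; exfalso; exact: nEr.
  have [e [Ee ex [eps [eps0 Fe]]]] : exists e, [/\ E e, `|e - x| < r &
      exists eps, 0 < eps /\ forall c, F n c -> eps <= `|e - c|].
    apply: contrapT => ne; apply: nF; exists n, x, r; split => // e Ee ex eps eps0.
    apply: contrapT => nc; apply: ne; exists e; split => //; exists eps.
    split => // c Fc; rewrite leNgt; apply/negP => ec.
    by apply: nc; exists c.
  (* The three bounds on the radius give strict separation from F n, halving, and nesting in the
     previous ball, respectively. *)
  exists (e, Num.min (eps / 2) (Num.min (r / 2) (r - `|e - x|))) => _ _ /=.
  rewrite !lt_min !divr_gt0//= subr_gt0 ex; split => //.
  - by rewrite !ge_min lexx !orbT.
  - by rewrite -lerBrDl !ge_min lexx !orbT.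
  - move=> c /Fe; apply: lt_le_trans; rewrite gt_min; apply/orP; left; lra.
move=> /choice[step stepP].
pose s := fix s n := if n is m.+1 then step (m, s m) else (x0, 1).
have sE n : E (s n).1 /\ 0 < (s n).2.
  elim: n => [//|n [En rn]].
  by have [? ? _ _ _] := stepP (n, s n) En rn.
have sP n : [/\ (s n.+1).2 <= (s n).2 / 2,
    `|(s n.+1).1 - (s n).1| + (s n.+1).2 <= (s n).2 &
    forall c, F n c -> (s n.+1).2 < `|(s n.+1).1 - c|].
  have [En rn] := sE n.
  by have [_ _ ? ? ?] := stepP (n, s n) En rn.
have s2 n : (s n).2 <= 1 / 2 ^+ n.
  elim: n => [|n IHn]; first by rewrite expr0 divr1.
  have [sn _ _] := sP n; apply: le_trans sn _.
  by rewrite exprSr invfM mulrA ler_wpM2r ?invr_ge0.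
have snest n k : `|(s (n + k)%N).1 - (s n).1| + (s (n + k)%N).2 <= (s n).2.
  elim: k => [|k IHk]; first by rewrite addn0 subrr normr0 add0r.
  have [_ sk _] := sP (n + k)%N; rewrite addnS.
  have := ler_distD (s (n + k)%N).1 (s (n + k).+1).1 (s n).1.
  lra.
have s20 : (s n).2 @[n --> \oo] --> 0.
  apply: (squeeze_cvgr _ (cvg_cst 0) (halves_cvg0 1)).
  by near=> n; rewrite s2 ltW//; exact: (sE n).2.
have [|y sy ys] := @cauchy_rate_cvg R X (fun n => (s n).1) (fun n => (s n).2) s20.
  move=> n m nm; have := snest n (m - n)%N; rewrite subnKC//.
  by apply: le_trans; rewrite lerDl ltW//; exact: (sE m).2.
have Ey : E y.
  apply: (closed_cvg (u_ := fun n => (s n).1) E cE _ y sy).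
  by near=> n; exact: (sE n).1.
(* The limit y is within the radius of the ball of index n + 1, whereas points of F n are farther
   than that from its centre. *)
have [n _ Fy] := EF y Ey.
have [_ _ sF] := sP n.
by have := sF _ Fy; rewrite ltNge distrC ys.
Unshelve. all: by end_near. Qed.

(** The weights 2^-(k+1) have total sum 1, so limits of these sums are infinite convex
    combinations. *)
Definition dyadic_sums {R : realType} {V : lmodType R} (c : nat -> V) (n : nat) :=
  \sum_(k < n) 2^-1 ^+ k.+1 *: c k.

Lemma dyadic_sumsS (R : realType) (V : lmodType R) (c : nat -> V) n :
  dyadic_sums c n.+1 = dyadic_sums c n + 2^-1 ^+ n.+1 *: c n.
Proof. by rewrite /dyadic_sums big_ord_recr. Qed.

(* Baire makes C dense in a ball of E; any e in half that ball is then expanded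
   greedily as a dyadic series of elements of C. *)
Lemma sigma_convex_ball (R : realType) (X : completeNormedModType R)
    (E C : set X) :
  closed E -> E 0 -> (forall t x y, E x -> E y -> E (t *: x + y)) ->
  C `<=` E -> (forall x, C x -> C (- x)) ->
  (forall x y, C x -> C y -> C (2^-1 *: (x + y))) ->
  (forall c e, (forall k, C (c k)) -> dyadic_sums c @ \oo --> e -> C e) ->
  (forall e, E e -> exists (n : nat) c, C c /\ e = n.+1%:R *: c) ->
  exists2 d, 0 < d & forall e, E e -> `|e| < d -> C e.
Proof.
move=> cE E0 EL CE CN Cmid Csigma Cabs.
have [||n [x [r [r0 Ex Fr]]]] :=
    @baire_closed R X E (fun n => [set n.+1%:R *: c | c in C]) cE.
- by exists 0.
- by move=> e /Cabs[n [c [Cc ->]]]; exists n => //; exists c.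
pose N : R := n.+1%:R; have N0 : 0 < N by rewrite ltr0n.
pose d := r / N; have d0 : 0 < d by rewrite divr_gt0.
have Cdense e : E e -> `|e| < d -> forall eps, 0 < eps ->
    exists2 c, C c & `|e - c| < eps.
  move=> Ee ed eps eps0.
  have Ner : `|N *: e| < r.
    by rewrite normrZ gtr0_norm// mulrC -ltr_pdivlMr.
  (* Approximating x + N e and x - N e by N c1 and N c2 and taking half the difference cancels the
     centre x: the ball of density moves to the origin. *)
  have [||_ [c1 Cc1 <-] ec1] := Fr (N *: e + x) _ _ (N * eps) (mulr_gt0 N0 eps0).
  - exact: EL.
  - by rewrite addrK.
  have [||_ [c2 Cc2 <-] ec2] :=
      Fr (- N *: e + x) _ _ (N * eps) (mulr_gt0 N0 eps0).
  - exact: EL.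
  - by rewrite addrK scaleNr normrN.
  exists (2^-1 *: (c1 + - c2)); first by apply: Cmid => //; exact: CN.
  have -> : e - 2^-1 *: (c1 - c2) = (2 * N)^-1 *:
      ((N *: e + x - N *: c1) - (- N *: e + x - N *: c2)).
    rewrite [X in _ = _ *: X](_ : _ = (2 * N) *: e - N *: (c1 - c2)).
      rewrite [RHS]scalerBr !scalerA mulVf ?scale1r ?mulf_neq0 ?gt_eqF//.
      by rewrite invfM mulfVK ?gt_eqF.
    rewrite scalerBr mulrC -scalerA scaler_nat mulr2n scalerDr scaleNr !opprD.
    rewrite !opprK -!addrA; congr (_ + _).
    rewrite (addrCA _ (N *: e)) (addrCA x (N *: e)); congr (_ + _).
    by rewrite (addrCA (- (N *: c1))) addNKr.
  rewrite normrZ gtr0_norm ?invr_gt0 ?mulr_gt0//.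
  rewrite ltr_pdivrMl ?mulr_gt0//; apply: le_lt_trans (ler_normB _ _) _.
  rewrite /N in ec1 ec2 *; lra.
have : forall y, exists c, E y -> `|y| < d -> C c /\ `|y - c| < d / 2.
  move=> y; have [[Ey yd]|nEy] := pselect (E y /\ `|y| < d).
    by have [|c Cc yc] := Cdense y Ey yd (d / 2); [exact: divr_gt0|exists c].
  by exists 0 => Ey yd; exfalso; exact: nEy.
move=> /choice[g gP].
exists (d / 2) => [|e Ee ed]; first exact: divr_gt0.
(* Rescaled remainders: after m terms the remainder is 2^-(m+1) y_m. An error below d / 2 doubles to
   stay below d; the start 2 e, due to the first weight 1/2, explains the radius d / 2. *)
pose y := fix y n := if n is m.+1 then 2 *: (y m - g (y m)) else 2 *: e.
have EZ t z : E z -> E (t *: z) by move=> Ez; rewrite -[_ *: _]addr0; exact: EL.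
have yP m : E (y m) /\ `|y m| < d.
  elim: m => [|m [Ey yd]] /=.
    split; first exact: EZ.
    by rewrite normrZ ger0_norm// mulrC -ltr_pdivlMr.
  have [/CE Eg gd] := gP _ Ey yd; split.
    by apply: EZ; rewrite addrC -scaleN1r; exact: EL.
  by rewrite normrZ ger0_norm// mulrC -ltr_pdivlMr.
have yS m : dyadic_sums (g \o y) m = e - 2^-1 ^+ m.+1 *: y m.
  elim: m => [|m IHm].
    by rewrite /dyadic_sums big_ord0 /= expr1 scalerA mulVf// scale1r subrr.
  rewrite dyadic_sumsS IHm /=.
  rewrite [in RHS]exprSr scalerA mulfVK// scalerBr opprB.
  by rewrite (addrC (2^-1 ^+ m.+1 *: g _)) addrA.
apply: (Csigma (g \o y)) => [k|].
  by have [Ey yd] := yP k; have [] := gP _ Ey yd.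
apply/cvgrPdist_le => eps eps0.
have /cvgrPdist_le/(_ _ eps0) := @halves_cvg0 R d.
apply: filterS => m; rewrite yS subKr sub0r normrN; apply: le_trans.
have [_ /ltW yd] := yP m.
rewrite normrZ normrM (gtr0_norm d0) mulrC -exprVn !ger0_norm ?exprn_ge0 ?invr_ge0//.
apply: ler_pM => //.
by rewrite exprS ler_piMl// invf_le1// ler1n.
Qed.

(** * Dyadic series in the space and in its dual *)

(** The weights from index n to n + k - 1 add up to 2^-n - 2^-(n+k); keeping the subtracted term
    lets the induction close. *)
Lemma dyadic_sums_dist (R : realType) (X : normedModType R) (c : nat -> X)
    (M : R) n k :
  (forall k, `|c k| <= M) ->
  `|dyadic_sums c (n + k) - dyadic_sums c n| <= M / 2 ^+ n - M / 2 ^+ (n + k).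
Proof.
move=> cM; elim: k => [|k IHk]; first by rewrite addn0 !subrr normr0.
rewrite addnS dyadic_sumsS addrAC; apply: le_trans (ler_normD _ _) _.
have : `|2^-1 ^+ (n + k).+1 *: c (n + k)%N| <= M / 2 ^+ (n + k).+1.
  rewrite normrZ exprVn ger0_norm ?invr_ge0 ?exprn_ge0// mulrC.
  by rewrite ler_wpM2r// invr_ge0 exprn_ge0.
have : M / 2 ^+ (n + k) = M / 2 ^+ (n + k).+1 + M / 2 ^+ (n + k).+1.
  by rewrite exprSr; field; rewrite expf_neq0.
lra.
Qed.

Lemma dyadic_sums_le (R : realType) (X : normedModType R) (c : nat -> X)
    (M : R) n :
  (forall k, `|c k| <= M) -> `|dyadic_sums c n| <= M.
Proof.
move=> cM; have M0 : 0 <= M := le_trans (normr_ge0 _) (cM 0%N).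
have := dyadic_sums_dist 0 n cM.
rewrite add0n {2}/dyadic_sums big_ord0 subr0 expr0 divr1 => /le_trans; apply.
by rewrite gerBl divr_ge0// exprn_ge0.
Qed.

Lemma dyadic_sums_cvg (R : realType) (X : completeNormedModType R)
    (c : nat -> X) (M : R) :
  (forall k, `|c k| <= M) ->
  exists2 l, dyadic_sums c @ \oo --> l & `|l| <= M.
Proof.
move=> cM; have M0 : 0 <= M := le_trans (normr_ge0 _) (cM 0%N).
have [|l cl _] := @cauchy_rate_cvg R X (dyadic_sums c) _ (halves_cvg0 M).
  move=> n m nm; have := dyadic_sums_dist n (m - n) cM; rewrite subnKC//.
  by move/le_trans; apply; rewrite gerBl divr_ge0// exprn_ge0.
exists l => //; apply: (cvgr_to_le (cvg_norm cl)).
by near=> n; exact: dyadic_sums_le.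
Unshelve. all: by end_near. Qed.

Lemma dyadic_sumsL (R : realType) (V : lmodType R) (t : R) (c d : nat -> V) n :
  dyadic_sums (fun k => t *: c k + d k) n
  = t *: dyadic_sums c n + dyadic_sums d n.
Proof.
rewrite /dyadic_sums scaler_sumr -big_split /=; apply: eq_bigr => i _.
by rewrite scalerDr !scalerA mulrC.
Qed.

Section Dual.
Context {R : realType} {X : normedModType R}.
Implicit Types (x y : X) (f g : dual X).

Lemma dualD f g x : (f + g) x = f x + g x. Proof. by []. Qed.
Lemma dualN f x : (- f) x = - f x. Proof. by []. Qed.
Lemma dualZ (t : R) f x : (t *: f) x = t * f x. Proof. by []. Qed.
Lemma dual0 x : (0 : dual X) x = 0. Proof. by []. Qed.

Lemma dual_appD f x y : f (x + y) = f x + f y. Proof. exact: raddfD. Qed.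
Lemma dual_appN f x : f (- x) = - f x. Proof. exact: raddfN. Qed.
Lemma dual_appZ f (t : R) x : f (t *: x) = t * f x. Proof. exact: linearZ. Qed.

Definition dualE :=
  (dualD, dualN, dualZ, dual0, dual_appD, dual_appN, dual_appZ).

Lemma dyadic_sums_dual (f : nat -> dual X) n x :
  dyadic_sums f n x = dyadic_sums (fun k => f k x : R^o) n.
Proof.
elim: n => [|n IHn]; first by rewrite /dyadic_sums !big_ord0.
by rewrite !dyadic_sumsS dualE IHn.
Qed.

(** Convergence in the dual is pointwise (weak-star), and membership in the dual unit ball is
    expressed by |f x| <= |x|. Scalar series converge at each x; linearity and the bound pass to the
    limit. *)
Lemma dyadic_sums_dual_cvg (f : nat -> dual X) :
  (forall k x, `|f k x| <= `|x|) ->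
  exists g : dual X, (forall x, dyadic_sums f n x @[n --> \oo] --> g x) /\
    forall x, `|g x| <= `|x|.
Proof.
move=> f1.
have : forall x, exists l : R^o,
    dyadic_sums (fun k => f k x : R^o) @ \oo --> l /\ `|l| <= `|x|.
  move=> x; have [l fl lx] := @dyadic_sums_cvg R R^o _ _ (f1 ^~ x).
  by exists l.
move=> /choice[g gP].
have lg : linear g.
  move=> t x y; have [gxy _] := gP (t *: x + y).
  have [gx _] := gP x; have [gy _] := gP y.
  apply: cvg_unique gxy _ => //.
  rewrite [X in dyadic_sums X](_ : _ = fun k => t *: (f k x : R^o) + f k y).
    rewrite (funext (dyadic_sumsL _ _ _)).
    by apply: cvgD => //; exact: cvgZl_tmp.
  by apply/funext => k; rewrite dual_appD dual_appZ.
have [|h hg] := bounded_linear_dual (f := g) (L := 1) lg.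
  by move=> x; rewrite mul1r; exact: (gP x).2.
exists h; split=> x; last by rewrite hg; exact: (gP x).2.
by rewrite hg (funext (fun n => dyadic_sums_dual f n x)); exact: (gP x).1.
Qed.

End Dual.

(** * Monotone and maximal monotone operators *)

Lemma pairing_oppr (R : realType) (X : normedModType R) (x y : X)
    (f g : dual X) :
  pairing (x - y) (f - g) = pairing (y - x) (g - f).
Proof. by rewrite /pairing !dualE; ring. Qed.

(** Adjoining (x0, f0) to the graph keeps it monotone, so maximality forces the point to be there
    already. *)
Lemma maximal_monotone_related (R : realType) (X : normedModType R)
    (A : X -> set (dual X)) (x0 : X) (f0 : dual X) :
  maximal_monotone A ->
  (forall x f, A x f -> 0 <= pairing (x - x0) (f - f0)) -> A x0 f0.
Proof.
move=> [monA maxA] rel0; apply: contrapT => nA0.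
pose B x := A x `|` [set f | x = x0 /\ f = f0].
have monB x f y g : B x f -> B y g -> 0 <= pairing (x - y) (f - g).
  move=> [Axf|[-> ->]] [Ayg|[-> ->]].
  - exact: (monA (x, f) (y, g)).
  - exact: rel0.
  - by rewrite pairing_oppr; exact: rel0.
  - by rewrite /pairing !dualE; lra.
apply: (maxA B); first by move=> [x f] [y g]; exact: monB.
split=> [z Az|BA]; first by left.
by apply: nA0; apply: (BA (x0, f0)); right.
Qed.

Lemma monotone_related_maximal (R : realType) (X : normedModType R)
    (A : X -> set (dual X)) :
  monotone_op A ->
  (forall x0 f0, (forall x f, A x f -> 0 <= pairing (x - x0) (f - f0)) ->
    A x0 f0) ->
  maximal_monotone A.
Proof.
move=> monA relA; split => // B monB [AB]; apply => -[x0 f0] Bx0.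
apply: relA => x f Axf.
by apply: (monB (x, f) (x0, f0)) => //; exact: AB.
Qed.

Lemma monotone_op_sum (R : realType) (X : normedModType R)
    (A B : X -> set (dual X)) :
  monotone_op A -> monotone_op B -> monotone_op (op_sum A B).
Proof.
move=> monA monB.
have monAB x y f g : op_sum A B x f -> op_sum A B y g ->
    0 <= pairing (x - y) (f - g).
  move=> [f1 Af1 [f2 Bf2 <-]] [g1 Ag1 [g2 Bg2 <-]].
  have : 0 <= pairing (x - y) (f1 - g1) := monA (x, f1) (y, g1) Af1 Ag1.
  have : 0 <= pairing (x - y) (f2 - g2) := monB (x, f2) (y, g2) Bf2 Bg2.
  by rewrite /pairing !dualE; lra.
by move=> [x f] [y g]; exact: monAB.
Qed.

(** The graph is closed under norm limits in X paired with bounded pointwise limits in the dual. The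
    only product of two varying factors is f_n (a_n - l), which the uniform bound K sends to 0. *)
Lemma maximal_monotone_limit (R : realType) (X : normedModType R)
    (A : X -> set (dual X)) (a : nat -> X) (f : nat -> dual X) (l : X)
    (g : dual X) (K : R) :
  maximal_monotone A -> (forall n, A (a n) (f n)) ->
  (forall n x, `|f n x| <= K * `|x|) ->
  a @ \oo --> l -> (forall x, f n x @[n --> \oo] --> g x) -> A l g.
Proof.
move=> maxA Aaf fK al fg; have [monA _] := maxA.
apply: maximal_monotone_related maxA _ => x h Axh.
have fal : f n (a n - l) @[n --> \oo] --> 0.
  apply/norm_cvg0P.
  apply: (squeeze_cvgr _ (cvg_cst 0)); last first.
    have := cvgMl_tmp (a := K) (cvg_norm (cvgB al (cvg_cst l))).
    by rewrite subrr normr0 mulr0; exact.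
  by near=> n; rewrite normr_ge0 fK.
have lim : pairing (x - a n) (h - f n) @[n --> \oo] --> pairing (x - l) (h - g).
  rewrite (_ : (fun n => _) = fun n =>
      h (x - a n) - f n x + (f n (a n - l) + f n l)); last first.
    by apply/funext => n; rewrite /pairing !dualE; ring.
  rewrite (_ : pairing _ _ = h (x - l) - g x + (0 + g l)); last first.
    by rewrite /pairing !dualE; ring.
  apply: cvgD; last by apply: cvgD => //; exact: fg.
  apply: cvgB => //.
  exact: (continuous_cvg _ (@functional_continuous _ _ h (x - l))
    (cvgB (cvg_cst x) al)).
apply: (cvgr_to_ge lim); near=> n.
exact: (monA (x, h) (a n, f n) Axh (Aaf n)).
Unshelve. all: by end_near. Qed.

(** * Linear operators and the bounded part of their graphs *)

Lemma linear_opP (R : realType) (X : normedModType R)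
    (A : X -> set (dual X)) :
  linear_op A -> A 0 0 /\ forall t x f y g, A x f -> A y g ->
    A (t *: x + y) (t *: f + g).
Proof.
move=> [A0 AL]; split; first by rewrite inE in A0.
move=> t x f y g Axf Ayg.
have := AL t (x, f) (y, g); rewrite !inE; exact.
Qed.

Lemma linear_opZD (R : realType) (X : normedModType R)
    (A : X -> set (dual X)) s t x y f g :
  linear_op A -> A x f -> A y g -> A (s *: x + t *: y) (s *: f + t *: g).
Proof.
move=> /linear_opP[A0 AL] Axf Ayg; apply: (AL s) => //.
by rewrite -[t *: y]addr0 -[t *: g]addr0; exact: AL.
Qed.

Lemma linear_op_domain (R : realType) (X : normedModType R)
    (A : X -> set (dual X)) t x y :
  linear_op A -> op_domain A x -> op_domain A y -> op_domain A (t *: x + y).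
Proof.
move=> /linear_opP[_ AL] [f Axf] [g Ayg]; exists (t *: f + g); exact: AL.
Qed.

(** The projection to X of the part of the graph lying in the product of the unit balls; it plays
    the role of the unit ball in the open mapping argument. *)
Definition unit_domain {R : realType} {X : normedModType R}
    (A : X -> set (dual X)) : set X :=
  [set x | `|x| <= 1 /\ exists2 f, A x f & forall y, `|f y| <= `|y|].

Section UnitDomain.
Context {R : realType} {X : completeNormedModType R} (A : X -> set (dual X)).
Context (linA : linear_op A) (maxA : maximal_monotone A).

Lemma unit_domainZD (s t : R) x y : `|s| + `|t| <= 1 ->
  unit_domain A x -> unit_domain A y -> unit_domain A (s *: x + t *: y).
Proof.
move=> st1 [x1 [f Axf f1]] [y1 [g Ayg g1]].
have stM (a b u v M : R) : `|a| <= `|s| * `|u| -> `|b| <= `|t| * `|v| ->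
    `|u| <= M -> `|v| <= M -> `|a + b| <= M.
  move=> au bv uM vM; have M0 := le_trans (normr_ge0 _) uM.
  apply: le_trans (ler_normD _ _) _; apply: (@le_trans _ _ ((`|s| + `|t|) * M)).
    rewrite mulrDl; apply: lerD; [apply: le_trans au _|apply: le_trans bv _];
      exact: ler_wpM2l.
  exact: ler_piMl.
split.
  apply: le_trans (ler_normD _ _) _; rewrite !normrZ.
  apply: le_trans st1; apply: lerD; exact: ler_piMr.
exists (s *: f + t *: g).
  exact: linear_opZD.
move=> z; rewrite !dualE; apply: (stM _ _ (f z) (g z)) => //;
  by rewrite normrM.
Qed.

Lemma unit_domainN x : unit_domain A x -> unit_domain A (- x).
Proof.
move=> Ux; rewrite -[- x]addr0 -(scale0r x) -scaleN1r.
by apply: unit_domainZD => //; rewrite normrN1 normr0 addr0.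
Qed.

Lemma unit_domain_absorbing x : op_domain A x ->
  exists2 M : R, 0 < M & forall s, M <= s -> unit_domain A (s^-1 *: x).
Proof.
move=> [f Axf]; have [L L0 fL] := dual_bounded f.
have [A0 AL] := linear_opP linA.
exists (L + `|x|) => [|s Ms]; first by rewrite ltr_wpDr.
have s0 : 0 < s by apply: lt_le_trans Ms; rewrite ltr_wpDr.
have x0 := normr_ge0 x.
split; first by rewrite normrZ normfV gtr0_norm// ler_pdivrMl// mulr1; lra.
exists (s^-1 *: f); first by have := AL s^-1 x f 0 0 Axf A0; rewrite !addr0.
move=> y; rewrite dualE normrM normfV (gtr0_norm s0) ler_pdivrMl//.
apply: le_trans (fL y) _; rewrite ler_wpM2r//; lra.
Qed.

Lemma dyadic_sums_op (c : nat -> X) (f : nat -> dual X) n :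
  (forall k, A (c k) (f k)) -> A (dyadic_sums c n) (dyadic_sums f n).
Proof.
move=> Acf; have [A0 AL] := linear_opP linA.
elim: n => [|n IHn]; first by rewrite /dyadic_sums !big_ord0.
by rewrite !dyadic_sumsS ![dyadic_sums _ _ + _]addrC; exact: AL.
Qed.

(** The points converge in norm by completeness and their images pointwise; maximality keeps the
    limit pair in the graph. *)
Lemma unit_domain_sigma_convex (c : nat -> X) :
  (forall k, unit_domain A (c k)) ->
  exists2 l, unit_domain A l & dyadic_sums c @ \oo --> l.
Proof.
move=> Uc.
have [l cl l1] := dyadic_sums_cvg (fun k => (Uc k).1).
have : forall k, exists f, A (c k) f /\ forall y, `|f y| <= `|y|.
  by move=> k; have [_ [f ? ?]] := Uc k; exists f.
move=> /choice[f fP].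
have [g [fg g1]] := dyadic_sums_dual_cvg (fun k => (fP k).2).
exists l => //; split => //; exists g => //.
apply: (maximal_monotone_limit (K := 1) maxA _ _ cl fg).
  by move=> n; apply: dyadic_sums_op => k; exact: (fP k).1.
move=> n x; rewrite mul1r dyadic_sums_dual.
by apply: dyadic_sums_le => k; exact: (fP k).2.
Qed.

End UnitDomain.

(** * The open mapping argument for the difference of the domains *)

(** The set C of differences of the two unit domains is symmetric, sigma-convex and absorbing in the
    closed space D(A) - D(B), hence contains a ball of it. *)
Lemma sum_domain_open (R : realType) (X : completeNormedModType R)
    (A B : X -> set (dual X)) :
  linear_op A -> maximal_monotone A -> linear_op B -> maximal_monotone B ->
  closed [set a - b | a in op_domain A & b in op_domain B] ->
  exists2 d, 0 < d & forall a b, op_domain A a -> op_domain B b ->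
    `|a - b| < d -> exists a' b',
    [/\ unit_domain A a', unit_domain B b' & a' - b' = a - b].
Proof.
move=> linA maxA linB maxB closedAB.
have [A0 _] := linear_opP linA; have [B0 _] := linear_opP linB.
pose C := [set a - b | a in unit_domain A & b in unit_domain B].
have [|t _ _ [a Aa [b Bb <-]] [a' Aa' [b' Bb' <-]]|_ [a [_ [f Aa _]] [b
    [_ [g Bb _]] <-]]|_ [a Aa [b Bb <-]]|_ _ [a Aa [b Bb <-]] [a' Aa'
    [b' Bb' <-]]|c e Cc ce|_ [a Aa [b Bb <-]]|d d0 Cd] :=
    sigma_convex_ball (C := C) closedAB.
- by exists 0; [exists 0|exists 0; [exists 0|rewrite subrr]].
- exists (t *: a + a'); first exact: linear_op_domain.
  exists (t *: b + b'); first exact: linear_op_domain.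
  by rewrite scalerBr opprD addrACA.
- by exists a; [exists f|exists b => //; exists g].
- exists (- a); first exact: unit_domainN.
  by exists (- b); [exact: unit_domainN|rewrite opprB opprK addrC].
- have half : `|2^-1| + `|2^-1| <= 1 :> R.
    by rewrite gtr0_norm ?invr_gt0//; lra.
  exists (2^-1 *: a + 2^-1 *: a'); first exact: unit_domainZD.
  exists (2^-1 *: b + 2^-1 *: b'); first exact: unit_domainZD.
  by rewrite -!scalerDr -scalerBr opprD addrACA.
(* The difference is written as - 1 *: b + a to match [dyadic_sumsL]. *)
- have : forall k, exists p : X * X,
      [/\ unit_domain A p.1, unit_domain B p.2 & c k = - 1 *: p.2 + p.1].
    move=> k; have [a Aa [b Bb ab]] := Cc k.
    by exists (a, b); split => //; rewrite scaleN1r addrC.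
  move=> /choice[p pP].
  have [a Aa pa] : exists2 l, unit_domain A l &
      dyadic_sums (fun k => (p k).1) @ \oo --> l.
    by apply: unit_domain_sigma_convex => // k; have [] := pP k.
  have [b Bb pb] : exists2 l, unit_domain B l &
      dyadic_sums (fun k => (p k).2) @ \oo --> l.
    by apply: unit_domain_sigma_convex => // k; have [] := pP k.
  exists a => //; exists b => //; apply: cvg_unique ce => //.
  rewrite (_ : c = fun k => -1 *: (p k).2 + (p k).1); last first.
    by apply/funext => k; have [] := pP k.
  rewrite (funext (dyadic_sumsL _ _ _)) addrC -[- b]scaleN1r.
  by apply: cvgD => //; exact: cvgZl_tmp.
- have [M _ AM] := unit_domain_absorbing linA Aa.
  have [K _ BK] := unit_domain_absorbing linB Bb.
  pose n := Num.trunc (Num.max M K).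
  have := truncnS_gt (Num.max M K); rewrite gt_max => /andP[/ltW Mn /ltW Kn].
  exists n, (n.+1%:R^-1 *: a - n.+1%:R^-1 *: b); split.
    exists (n.+1%:R^-1 *: a); first exact: (AM _ Mn).
    by exists (n.+1%:R^-1 *: b); first exact: (BK _ Kn).
  by rewrite -scalerBr scalerA divff ?scale1r// pnatr_eq0.
- exists d => // a b Aa Bb abd.
  have [|//|a' Aa' [b' Bb' ab]] := Cd (a - b); first by exists a => //; exists b.
  by exists a', b'.
Qed.

(** * Maximality of the sum *)

Section SumMaximal.
Context {R : realType} {X : completeNormedModType R} (A B : X -> set (dual X)).
Context (linA : linear_op A) (maxA : maximal_monotone A).
Context (linB : linear_op B) (maxB : maximal_monotone B).
Context (x0 : X) (h0 : dual X).

Let W := ((X * dual X) * (X * dual X))%type.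

Let gap (w : W) : R :=
  pairing (w.1.1 - x0) w.1.2 + pairing (w.2.1 - x0) (w.2.2 - h0).

Let G : set W := [set w | A w.1.1 w.1.2 /\ B w.2.1 w.2.2].

Lemma gapE a f b g : gap ((a, f), (b, g)) =
  f a - f x0 + (g b - g x0 - (h0 b - h0 x0)).
Proof.
rewrite -[LHS]/(pairing (a - x0) f + pairing (b - x0) (g - h0)).
by rewrite /pairing !dualE; ring.
Qed.

(** The convexity defect is exactly s t (<a - a', f - f'> + <b - b', g - g'>), nonnegative by
    monotonicity of A and B. *)
Lemma gap_convex s t u v : 0 <= s -> 0 <= t -> s + t = 1 -> G u -> G v ->
  G (s *: u + t *: v) /\ gap (s *: u + t *: v) <= s * gap u + t * gap v.
Proof.
move: u v => [[a f] [b g]] [[a' f'] [b' g']] s0 t0 st [/= Aa Bb] [/= Aa' Bb'].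
split; first by split; exact: linear_opZD.
have : 0 <= pairing (a - a') (f - f') := maxA.1 (a, f) (a', f') Aa Aa'.
have : 0 <= pairing (b - b') (g - g') := maxB.1 (b, g) (b', g') Bb Bb'.
rewrite -[s *: _ + _]/((s *: a + t *: a', s *: f + t *: f'),
  (s *: b + t *: b', s *: g + t *: g')).
rewrite !gapE /pairing !dualE => gb fa; rewrite -subr_ge0.
have := mulr_ge0 (mulr_ge0 s0 t0) (addr_ge0 fa gb); congr (0 <= _).
have -> : t = 1 - s by lra.
ring.
Qed.


Context
  (closedAB : closed [set a - b | a in op_domain A & b in op_domain B])
  (rel0 : forall x h, op_sum A B x h -> 0 <= pairing (x - x0) (h - h0)).

Lemma gap_diag w : G w -> w.1.1 = w.2.1 -> 0 <= gap w.
Proof.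
move: w => [[a f] [b g]] [/= Aa Bb] ab; rewrite -ab in Bb.
have : op_sum A B a (f + g) by exists f => //; exists g.
by move=> /rel0; rewrite gapE /pairing -ab !dualE; lra.
Qed.

(** A point w of G is mixed with a bounded point w' of G whose difference a - b is - s times that of
    w. The mixture lies on the diagonal, so s gap(w) + gap(w') >= 0, while gap(w') <= M. *)
Lemma gap_lower_bound : exists2 L, 0 <= L &
  forall w, G w -> - (L * `|w.1.1 - w.2.1|) <= gap w.
Proof.
have [d d0 dopen] := sum_domain_open linA maxA linB maxB closedAB.
have [K K0 hK] := dual_bounded h0.
(* For w' in the unit domains, f (a - x0) and g (b - x0) are at most 1 + |x0|, and - h0 (b - x0) at
   most K (1 + |x0|). *)
pose M := (1 + `|x0|) * (2 + K).
have x0_ge0 := normr_ge0 x0.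
have M0 : 0 < M by rewrite mulr_gt0//; lra.
exists (2 * M / d) => [|w Gw].
  by rewrite ltW// divr_gt0// mulr_gt0.
have [w0|w_neq0] := eqVneq `|w.1.1 - w.2.1| 0.
  rewrite w0 mulr0 oppr0; apply: gap_diag => //.
  by apply/eqP; rewrite -subr_eq0 -normr_eq0 w0.
(* Scaling by s brings the difference to norm d / 2, inside the open ball of radius d; then M / s is
   the claimed bound. *)
pose s := d / (2 * `|w.1.1 - w.2.1|).
have n0 : 0 < `|w.1.1 - w.2.1| by rewrite lt_def w_neq0 normr_ge0.
have s0 : 0 < s by rewrite divr_gt0// mulr_gt0.
have [A0 AL] := linear_opP linA; have [B0 BL] := linear_opP linB.
have [|||a [b [[a1 [f Aa f1]] [b1 [g Bb g1]] ab]]] :=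
    dopen (- s *: w.1.1) (- s *: w.2.1).
- by exists (- s *: w.1.2); have := AL (- s) _ _ _ _ Gw.1 A0; rewrite !addr0.
- by exists (- s *: w.2.2); have := BL (- s) _ _ _ _ Gw.2 B0; rewrite !addr0.
- rewrite -scalerBr normrZ normrN gtr0_norm// /s invfM mulrA mulfVK//.
  by rewrite gtr_pMr// invf_lt1// ltr1n.
pose w' : W := ((a, f), (b, g)).
have Gw' : G w' by [].
have gapM : gap w' <= M.
  have f0 : f (a - x0) <= 1 + `|x0|.
    apply: le_trans (ler_norm _) _; apply: le_trans (f1 _) _.
    by apply: le_trans (ler_normB _ _) _; rewrite lerD2r.
  have bx : `|b - x0| <= 1 + `|x0|.
    by apply: le_trans (ler_normB _ _) _; rewrite lerD2r.
  have g0 : g (b - x0) <= 1 + `|x0|.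
    by apply: le_trans (ler_norm _) _; apply: le_trans (g1 _) _.
  have h0b : - h0 (b - x0) <= K * (1 + `|x0|).
    apply: le_trans (ler_norm _) _; rewrite normrN; apply: le_trans (hK _) _.
    by rewrite ler_wpM2l// ltW.
  move: f0 g0 h0b; rewrite /w' gapE /M !dualE; lra.
have s1 : 0 < s + 1 by rewrite addr_gt0.
have [|||Gc gapc] := @gap_convex (s / (s + 1)) (1 / (s + 1)) w w' _ _ _ Gw Gw'.
- by rewrite divr_ge0// ltW.
- by rewrite divr_ge0// ltW.
- by rewrite -mulrDl divff// gt_eqF.
have := gap_diag Gc.
rewrite -[X in X = _ -> _]/(s / (s + 1) *: w.1.1 + 1 / (s + 1) *: a).
rewrite -[X in _ = X -> _]/(s / (s + 1) *: w.2.1 + 1 / (s + 1) *: b) => diag.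
have {}diag : 0 <= s / (s + 1) * gap w + 1 / (s + 1) * gap w'.
  apply: le_trans gapc; apply: diag.
  apply/eqP; rewrite -subr_eq0 opprD addrACA -!scalerBr ab -scalerBr scalerA.
  by rewrite -scalerDl [X in X *: _](_ : _ = 0) ?scale0r//; ring.
have {}diag : 0 <= s * gap w + gap w'.
  rewrite -(pmulr_rge0 _ (_ : 0 < (s + 1)^-1)) ?invr_gt0//.
  by move: diag; congr (0 <= _); ring.
have -> : 2 * M / d * `|w.1.1 - w.2.1| = M / s.
  by rewrite /s; field; rewrite w_neq0 gt_eqF.
by rewrite lerNl ler_pdivlMr//; lra.
Qed.

Lemma gap_minorant : exists z : dual X,
  forall w, G w -> z (w.1.1 - w.2.1) <= gap w.
Proof.
have [L L0 gapL] := gap_lower_bound.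
pose T (w : W) : X := w.1.1 - w.2.1.
have lT : linear T.
  by move=> t u v; rewrite /T /= scalerBr opprD addrACA.
pose T' : {linear W -> X} := HB.pack T (GRing.isLinear.Build _ _ _ _ T lT).
apply: (convex_sandwich (T := T') _ L0 gap_convex gapL).
have [A0 _] := linear_opP linA; have [B0 _] := linear_opP linB.
by exists 0.
Qed.

Lemma op_sum_related : op_sum A B x0 h0.
Proof.
have [z zgap] := gap_minorant.
have rel a f b g : A a f -> B b g ->
    0 <= pairing (a - x0) (f - z) + pairing (b - x0) (g - (h0 - z)).
  move=> Aa Bb; have := zgap ((a, f), (b, g)) (conj Aa Bb).
  by rewrite gapE /pairing !dualE; lra.
have self (h : dual X) : pairing (x0 - x0) (h - h) = 0.
  by rewrite /pairing !dualE; lra.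
have Ax0 : A x0 z.
  apply: maximal_monotone_related maxA _ => a f Aa.
  (* A negative term from A forces all terms from B to be positive, hence (x0, h0 - z) is in B;
     testing there makes the B term 0, a contradiction. *)
  rewrite leNgt; apply/negP => a_lt0.
  have Bx0 : B x0 (h0 - z).
    apply: maximal_monotone_related maxB _ => b g Bb.
    by have := rel _ _ _ _ Aa Bb; lra.
  by have := rel _ _ _ _ Aa Bx0; rewrite self; lra.
exists z => //; exists (h0 - z); last by rewrite addrC subrK.
(* Now (x0, z) is in A, and testing there removes the A term. *)
apply: maximal_monotone_related maxB _ => b g Bb.
by have := rel _ _ _ _ Ax0 Bb; rewrite self add0r.
Qed.

End SumMaximal.

Theorem theorem1 (R : realType) (X : completeNormedModType R)
    (A B : X -> set (dual X))
    (linA : linear_op A) (maxA : maximal_monotone A)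
    (linB : linear_op B) (maxB : maximal_monotone B)
    (closedAB : closed [set a - b | a in op_domain A & b in op_domain B]) :
  maximal_monotone (op_sum A B).
Proof.
apply: monotone_related_maximal => [|x0 h0].
  by apply: monotone_op_sum; [exact: maxA.1|exact: maxB.1].
exact: op_sum_related.
Qed.
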